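(* Let $\lambda=-1$. Let $\gamma(s)=(x(s),0,z(s))$, with angle function $\theta(s)$, be the maximal solution of $$x'(s)=\cos\theta(s),\qquad z'(s)=\sin\theta(s),\qquad \theta'(s)=x(s)\frac{\cos\theta(s)}{\sin\theta(s)}+\lambda\frac{x(s)}{\sin\theta(s)},$$ with initial conditions $x(0)=1$, $z(0)=0$, $\theta(0)=\frac{\pi}{2}$. Then $\gamma$ is a graph on the $z$-axis. Moreover, $\gamma$ has a branch asymptotic to a horizontal line and the other branch ends at finite time.
   Context: The system is the condition that the rotational surface $\Psi(s,t)=(x(s)\cos t,x(s)\sin t,z(s))$, with arc-length generating curve $\gamma$, has Gauss curvature $K=\langle N,(0,0,1)\rangle+\lambda$, i.e. is a $\lambda$-translator with speed $(0,0,1)$. The system is defined where $\sin\theta\neq0$, so the solution lives on a maximal interval $I\ni 0$ on which $\theta\in(0,\pi)$. The two branches of $\gamma$ are its restrictions to $s>0$ and to $s<0$ in $I$. ''Graph on the $z$-axis'' means $\gamma$ is of the form $x=h(z)$ for a function $h$ on an interval of the $z$-axis. ''Horizontal line'' means a line in the $xz$-plane parallel to the $x$-axis; a branch is asymptotic to it if $x\to\infty$ and $z$ tends to a finite limit along the branch. ''Ends at finite time'' means the corresponding endpoint of $I$ is finite. *)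

(* Defs.v *)
From Stdlib Require Import Reals.
From Coquelicot Require Import Coquelicot.
Open Scope R_scope.

Definition in_Rbar_interval (a b : Rbar) (s : R) : Prop :=
  Rbar_lt a s /\ Rbar_lt s b.

(* The functions are total on [R]; only their values on the open interval
   [(a, b)] are constrained.  [sin (theta s) <> 0] is the domain of the
   system: with [theta 0 = PI / 2] it means that [theta] stays in [(0, PI)]. *)
Definition is_solution (lambda : R) (a b : Rbar) (x z theta : R -> R) : Prop :=
  forall s : R, in_Rbar_interval a b s ->
    sin (theta s) <> 0 /\
    is_derive x s (cos (theta s)) /\
    is_derive z s (sin (theta s)) /\
    is_derive theta s
      (x s * (cos (theta s) / sin (theta s)) + lambda * (x s / sin (theta s))).

Definition is_maximal_solution
    (lambda : R) (a b : Rbar) (x z theta : R -> R) : Prop :=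
  is_solution lambda a b x z theta /\
  forall (a' b' : Rbar) (x' z' theta' : R -> R),
    Rbar_le a' a -> Rbar_le b b' ->
    is_solution lambda a' b' x' z' theta' ->
    (forall s : R, in_Rbar_interval a b s ->
       x' s = x s /\ z' s = z s /\ theta' s = theta s) ->
    a' = a /\ b' = b.

Definition gamma (x z : R -> R) (s : R) : R * R * R := (x s, 0, z s).

Definition is_interval (J : R -> Prop) : Prop :=
  forall u v w : R, J u -> J v -> u <= w <= v -> J w.

(* The trace of the curve over [(a, b)] is exactly [{x = h(z), z in J}]. *)
Definition graph_on_z_axis (a b : Rbar) (x z : R -> R) : Prop :=
  exists (J : R -> Prop) (h : R -> R),
    is_interval J /\
    forall p : R * R * R,
      (exists s : R, in_Rbar_interval a b s /\ gamma x z s = p) <->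
      (exists w : R, J w /\ p = (h w, 0, w)).

(* For [e] an endpoint of [(a, b)], finite or infinite: the filter of [s]
   tending to [e] from inside [(a, b)]. *)
Definition at_endpoint (a b e : Rbar) : (R -> Prop) -> Prop :=
  within (in_Rbar_interval a b) (Rbar_locally' e).

(* [e = b] gives the branch [s > 0] and [e = a] the branch [s < 0]. *)
Definition branch_asymptotic_to_horizontal_line
    (a b e : Rbar) (x z : R -> R) : Prop :=
  exists c : R,
    filterlim x (at_endpoint a b e) (Rbar_locally p_infty) /\
    filterlim z (at_endpoint a b e) (locally c).

(* Main.v *)
Require Import Defs.
From Stdlib Require Import Reals.
From Coquelicot Require Import Coquelicot.
From Stdlib Require Import Lra Classical ClassicalEpsilon Ranalysis5.
Open Scope R_scope.

(** For lambda = -1 the third equation reads theta' = - x tan (theta / 2), and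
    the system is integrable by quadratures.  Put m = - ln (1 - cos theta).
    Then m' = x and x' = cos theta = 1 - exp (- m), so that
    x^2 - 2 exp (- m) - 2 m is constant; the initial conditions give
    x^2 = 2 exp (- m) + 2 m - 1.  The right-hand side is at least 1 for every
    real m because exp (- m) >= 1 - m, hence x never vanishes and
    x = radius m > 0.  The parameter m therefore increases strictly along the
    curve, and integrating ds = dm / x and dz = sin theta dm / x gives
    s = arc_length m and z = height m.  This determines every solution on any
    interval ([solution_is_explicit]), which is all the uniqueness needed.

    The angle lies in (0, PI) exactly when m > - ln 2.  Conversely,
    [arc_length] is a smooth increasing bijection from (- ln 2, +oo) to
    (arc_length (- ln 2), +oo): it is unbounded since radius m <= 1 + m for
    m >= 0.  Inverting it yields a solution on that whole interval
    ([explicit_is_solution]).  Every solution with the given initial data being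
    a restriction of this one, the maximal solution lives on exactly that
    interval ([maximal_solution_interval]); its left endpoint is finite.

    Along the branch s -> +oo the parameter m tends to +oo, so radius m tends
    to +oo, while [height] is increasing and bounded, its derivative being at
    most 2 exp (- m / 2).  Finally [height] is strictly increasing on
    (- ln 2, +oo), so m, and with it x, is a function of z. *)

(** * Calculus on intervals *)

Lemma continuity_pt_of_derive (f : R -> R) (x l : R) :
  is_derive f x l -> continuity_pt f x.
Proof.
  intros H. apply continuity_pt_filterlim.
  apply (ex_derive_continuous (V := R_NormedModule)). now exists l.
Qed.

Lemma in_Rbar_interval_between (a b : Rbar) (u v w : R) :
  in_Rbar_interval a b u -> in_Rbar_interval a b v ->
  Rmin u v <= w <= Rmax u v -> in_Rbar_interval a b w.
Proof.
  unfold in_Rbar_interval, Rmin, Rmax.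
  intros [Hu1 Hu2] [Hv1 Hv2] Hw.
  destruct a as [a| |], b as [b| |], (Rle_dec u v); simpl in *; split;
    trivial; lra.
Qed.

Lemma constant_on_interval (a b : Rbar) (f : R -> R) (u v : R) :
  (forall s, in_Rbar_interval a b s -> is_derive f s 0) ->
  in_Rbar_interval a b u -> in_Rbar_interval a b v -> f v = f u.
Proof.
  intros Hf Hu Hv.
  destruct (MVT_gen f u v (fun _ => 0)) as [c [_ Hc]].
  - intros s Hs. apply Hf, (in_Rbar_interval_between a b u v); trivial; lra.
  - intros s Hs. apply (continuity_pt_of_derive f s 0), Hf.
    now apply (in_Rbar_interval_between a b u v).
  - lra.
Qed.

(** The intermediate value theorem in the form of a connectedness argument:
    it confines theta to (0, PI) and fixes the sign of x. *)
Lemma positive_on_interval (a b : Rbar) (f : R -> R) (u v : R) :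
  (forall s, in_Rbar_interval a b s -> continuity_pt f s) ->
  (forall s, in_Rbar_interval a b s -> f s <> 0) ->
  in_Rbar_interval a b u -> in_Rbar_interval a b v -> 0 < f u -> 0 < f v.
Proof.
  intros Hc Hf Hu Hv Hfu.
  destruct (Rtotal_order (f v) 0) as [Hneg | [Hz | Hpos]]; trivial.
  2: now destruct (Hf v Hv).
  exfalso.
  destruct (Rtotal_order u v) as [Huv | [Huv | Huv]].
  - destruct (IVT_interv (fun s => - f s) u v) as [c [Hc1 Hc2]]; try lra.
    + intros s Hs. apply continuity_pt_opp, Hc.
      apply (in_Rbar_interval_between a b u v); trivial.
      rewrite Rmin_left, Rmax_right; lra.
    + apply (Hf c); [|lra].
      apply (in_Rbar_interval_between a b u v); trivial.
      rewrite Rmin_left, Rmax_right; lra.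
  - subst v. lra.
  - destruct (IVT_interv f v u) as [c [Hc1 Hc2]]; try lra.
    + intros s Hs. apply Hc.
      apply (in_Rbar_interval_between a b u v); trivial.
      rewrite Rmin_right, Rmax_left; lra.
    + apply (Hf c); [|lra].
      apply (in_Rbar_interval_between a b u v); trivial.
      rewrite Rmin_right, Rmax_left; lra.
Qed.

Lemma nondecreasing_of_derive (f df : R -> R) (u v : R) :
  (forall x, u <= x <= v -> is_derive f x (df x)) ->
  (forall x, u <= x <= v -> 0 <= df x) ->
  u <= v -> f u <= f v.
Proof.
  intros Hf Hdf Huv.
  destruct (MVT_gen f u v df) as [c [Hc Heq]];
    rewrite ?Rmin_left, ?Rmax_right in * by lra.
  - intros x Hx. apply Hf. lra.
  - intros x Hx. now apply (continuity_pt_of_derive f x (df x)), Hf.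
  - assert (0 <= df c * (v - u)) by (apply Rmult_le_pos; [now apply Hdf | lra]).
    lra.
Qed.

Lemma is_derive_primitive (f : R -> R) (x : R) :
  (forall y, continuous f y) -> is_derive (fun y => RInt f 0 y) x (f x).
Proof.
  intros Hf. apply (is_derive_RInt (V := R_NormedModule) f _ 0); trivial.
  apply filter_forall. intros y. apply (RInt_correct (V := R_CompleteNormedModule)).
  apply (ex_RInt_continuous (V := R_CompleteNormedModule)). intros; apply Hf.
Qed.

Lemma intermediate_value (f : R -> R) (u v y : R) :
  (forall x, u <= x <= v -> continuity_pt f x) ->
  u <= v -> f u <= y <= f v -> exists x, u <= x <= v /\ f x = y.
Proof.
  intros Hf Huv Hy.
  destruct (Req_dec (f u) y) as [Hu | Hu]; [exists u; lra|].
  destruct (Req_dec (f v) y) as [Hv | Hv]; [exists v; lra|].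
  destruct (Req_dec u v) as [E | E]; [subst v; lra|].
  destruct (IVT_interv (fun x => f x - y) u v) as [x [Hx Hfx]]; try lra.
  - intros x Hx. apply continuity_pt_minus; [now apply Hf|].
    now apply continuity_pt_const.
  - exists x; lra.
Qed.

Lemma exp_nondecreasing (x y : R) : x <= y -> exp x <= exp y.
Proof.
  intros [H | ->]; [left; now apply exp_increasing | apply Rle_refl].
Qed.

(** * Inverse of an increasing function *)

(** Chosen by [epsilon], so that it is total; its value is meaningful only on
    the range of [f]. *)
Definition preimage (f : R -> R) (y : R) : R :=
  epsilon (inhabits 0) (fun x => f x = y).

Lemma increasing_of_derive (f df : R -> R) (u v : R) :
  (forall x, is_derive f x (df x)) -> (forall x, 0 < df x) ->
  u < v -> f u < f v.
Proof.
  intros Hf Hdf Huv.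
  apply (incr_function f m_infty p_infty df); simpl; trivial.
  intros x _ _. apply Hdf.
Qed.

Lemma preimage_image (f df : R -> R) (x : R) :
  (forall x, is_derive f x (df x)) -> (forall x, 0 < df x) ->
  preimage f (f x) = x.
Proof.
  intros Hf Hdf.
  assert (E : f (preimage f (f x)) = f x)
    by (apply (epsilon_spec (inhabits 0) (fun u => f u = f x)); now exists x).
  destruct (Rtotal_order (preimage f (f x)) x) as [H | [H | H]]; trivial;
    apply (increasing_of_derive f df) in H; trivial; lra.
Qed.

(** The inverse function theorem in dimension one.  [f] need not be
    onto: by the intermediate value theorem on [x - 1, x + 1] it takes all
    values near [f x]. *)
Lemma is_derive_preimage (f df : R -> R) (x : R) :
  (forall x, is_derive f x (df x)) -> (forall x, 0 < df x) ->
  is_derive (preimage f) (f x) (/ df x).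
Proof.
  intros Hf Hdf.
  assert (Hinj : forall y, preimage f (f y) = y)
    by (intros y; now apply (preimage_image f df)).
  assert (Hincr : forall u v, u < v -> f u < f v)
    by (intros u v; now apply (increasing_of_derive f df)).
  assert (Hc : forall y, continuity_pt f y)
    by (intros y; apply (continuity_pt_of_derive f y (df y)), Hf).
  assert (Hl := Hincr (x - 1) x ltac:(lra)).
  assert (Hr := Hincr x (x + 1) ltac:(lra)).
  assert (Hinv : forall y, f (x - 1) <= y <= f (x + 1) ->
            f (preimage f y) = y /\ x - 1 <= preimage f y <= x + 1).
  { intros y Hy.
    destruct (intermediate_value f (x - 1) (x + 1) y) as [u [Hu E]];
      auto; [lra|].
    rewrite <- E, Hinj. auto. }
  assert (Hd : forall y, derivable_pt f y)
    by (intros y; exists (df y); now apply is_derive_Reals).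
  assert (Hrange : preimage f (f (x - 1)) <= preimage f (f x)
                   <= preimage f (f (x + 1)))
    by (rewrite !Hinj; lra).
  assert (Hval : derive_pt f (preimage f (f x)) (Hd (preimage f (f x))) = df x).
  { apply derive_pt_eq_0. rewrite Hinj. now apply is_derive_Reals. }
  apply is_derive_Reals.
  replace (/ df x) with
    (1 / derive_pt f (preimage f (f x)) (Hd (preimage f (f x))))
    by (rewrite Hval; unfold Rdiv; ring).
  refine (derivable_pt_lim_recip_interv f (preimage f) (f (x - 1)) (f (x + 1))
            (f x) (fun y _ => Hd y) _ _ _ Hrange _ _); try lra.
  - apply (continuity_pt_recip_interv f (preimage f) (x - 1) (x + 1));
      auto; try lra.
    + intros y H1 H2. now apply Hinv.
    + intros y H1 H2. now apply Hinv.
  - intros y Hy. now apply Hinv.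
  - rewrite Hval. specialize (Hdf x). lra.
Qed.

(** * The explicit profile curve *)

(** The curve is described by the parameter m = - ln (1 - cos theta):
    [radius] is the coordinate x, [height] the coordinate z, and [cos_angle],
    [sin_angle] are the cosine and sine of theta.  All of them are continuous
    on the whole line, although they describe a solution only for
    m > - ln 2, where [cos_angle] exceeds -1. *)
Definition radius (m : R) : R := sqrt (2 * exp (- m) + 2 * m - 1).
Definition cos_angle (m : R) : R := 1 - exp (- m).
Definition sin_angle (m : R) : R := sqrt (1 - (cos_angle m)²).
Definition arc_length (m : R) : R := RInt (fun u => / radius u) 0 m.
Definition height (m : R) : R := RInt (fun u => sin_angle u / radius u) 0 m.

(** Convexity of the exponential; this keeps the curve at distance at least 1
    from the axis of rotation. *)
Lemma radius_sqr_ge_1 (m : R) : 1 <= 2 * exp (- m) + 2 * m - 1.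
Proof. generalize (exp_ineq1_le (- m)). lra. Qed.

Lemma radius_ge_1 (m : R) : 1 <= radius m.
Proof.
  rewrite <- sqrt_1. apply sqrt_le_1_alt, radius_sqr_ge_1.
Qed.

Lemma is_derive_radius (m : R) : is_derive radius m (cos_angle m / radius m).
Proof.
  assert (H := radius_sqr_ge_1 m). assert (H' := radius_ge_1 m).
  unfold radius, cos_angle in *. auto_derive; [lra|].
  replace (2 * exp (- m) + 2 * m + - (1))
    with (2 * exp (- m) + 2 * m - 1) by ring.
  field. lra.
Qed.

Lemma continuous_radius (m : R) : continuous radius m.
Proof.
  apply (ex_derive_continuous (V := R_NormedModule)). eexists. apply is_derive_radius.
Qed.

Lemma continuous_sin_angle (m : R) : continuous sin_angle m.
Proof.
  unfold sin_angle.
  apply (continuous_comp (fun u => 1 - (cos_angle u)²) sqrt).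
  - apply (ex_derive_continuous (V := R_NormedModule)).
    unfold cos_angle, Rsqr. auto_derive. trivial.
  - apply continuous_sqrt.
Qed.

Lemma continuous_inv_radius (m : R) : continuous (fun u => / radius u) m.
Proof.
  apply (continuous_comp radius Rinv).
  - apply continuous_radius.
  - apply continuous_Rinv. generalize (radius_ge_1 m). lra.
Qed.

Lemma is_derive_arc_length (m : R) : is_derive arc_length m (/ radius m).
Proof.
  apply (is_derive_primitive (fun u => / radius u)), continuous_inv_radius.
Qed.

Lemma is_derive_height (m : R) : is_derive height m (sin_angle m / radius m).
Proof.
  apply (is_derive_primitive (fun u => sin_angle u / radius u)).
  intros u. apply (continuous_mult (K := R_AbsRing)).
  - apply continuous_sin_angle.
  - apply continuous_inv_radius.
Qed.

Lemma inv_radius_pos (m : R) : 0 < / radius m.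
Proof. apply Rinv_0_lt_compat. generalize (radius_ge_1 m). lra. Qed.

Lemma arc_length_incr (u v : R) : u < v -> arc_length u < arc_length v.
Proof.
  apply (increasing_of_derive arc_length _ u v is_derive_arc_length inv_radius_pos).
Qed.

Lemma arc_length_0 : arc_length 0 = 0.
Proof. apply (RInt_point (V := R_CompleteNormedModule)). Qed.

Lemma height_0 : height 0 = 0.
Proof. apply (RInt_point (V := R_CompleteNormedModule)). Qed.

(** A lower bound that shows [arc_length] to be unbounded, hence the solution to
    exist for all positive times.  It comes from radius u <= 1 + u. *)
Lemma arc_length_ge_ln (m : R) : 0 <= m -> ln (1 + m) <= arc_length m.
Proof.
  intros Hm.
  assert (H : arc_length 0 - ln (1 + 0) <= arc_length m - ln (1 + m)).
  { apply (nondecreasing_of_derive (fun u => arc_length u - ln (1 + u))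
             (fun u => / radius u - / (1 + u))); trivial.
    - intros u Hu. apply (is_derive_minus arc_length (fun u => ln (1 + u))).
      + apply is_derive_arc_length.
      + auto_derive; [lra|]. field. lra.
    - intros u Hu.
      assert (/ (1 + u) <= / radius u); [|lra].
      apply Rinv_le_contravar; [generalize (radius_ge_1 u); lra|].
      rewrite <- (sqrt_Rsqr (1 + u)) by lra.
      apply sqrt_le_1_alt. unfold Rsqr.
      assert (exp (- u) <= 1)
        by (rewrite <- exp_0; apply exp_nondecreasing; lra).
      nra. }
  rewrite arc_length_0, Rplus_0_r, ln_1 in H. lra.
Qed.

Lemma arc_length_surj (m0 s : R) :
  arc_length m0 < s -> exists m, m0 < m /\ arc_length m = s.
Proof.
  intros Hs.
  (* [arc_length_ge_ln] gives arc_length (e^S - 1) >= S for S >= 0 *)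
  set (m1 := Rmax m0 (exp (Rmax 0 s) - 1)).
  assert (Hm1 : s <= arc_length m1).
  { assert (H1 : exp (Rmax 0 s) - 1 <= m1) by apply Rmax_r.
    assert (H2 : 1 <= exp (Rmax 0 s))
      by (rewrite <- exp_0; apply exp_nondecreasing, Rmax_l).
    assert (H3 : ln (exp (Rmax 0 s)) <= ln (1 + m1)) by (apply ln_le; lra).
    rewrite ln_exp in H3.
    generalize (Rmax_r 0 s) (arc_length_ge_ln m1 ltac:(lra)). lra. }
  destruct (intermediate_value arc_length m0 m1 s) as [m [Hm E]].
  - intros u _. apply (continuity_pt_of_derive _ _ _ (is_derive_arc_length u)).
  - apply Rmax_l.
  - lra.
  - exists m. split; trivial.
    destruct (Req_dec m m0) as [->|]; lra.
Qed.

Lemma cos_angle_bounds (m : R) : - ln 2 < m -> -1 < cos_angle m < 1.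
Proof.
  intros Hm. unfold cos_angle.
  assert (H : exp (- m) < exp (ln 2)) by (apply exp_increasing; lra).
  rewrite exp_ln in H by lra. generalize (exp_pos (- m)). lra.
Qed.

Lemma sin_angle_pos (m : R) : - ln 2 < m -> 0 < sin_angle m.
Proof.
  intros Hm. apply sqrt_lt_R0. generalize (cos_angle_bounds m Hm).
  unfold Rsqr. nra.
Qed.

Lemma height_incr (u v : R) : - ln 2 < u -> u < v -> height u < height v.
Proof.
  intros Hu Huv.
  apply (incr_function height (- ln 2) p_infty (fun m => sin_angle m / radius m));
    simpl; trivial.
  - intros m _ _. apply is_derive_height.
  - intros m Hm _. apply Rmult_lt_0_compat.
    + now apply sin_angle_pos.
    + apply inv_radius_pos.
Qed.

(** Near the end the curve becomes horizontal exponentially fast: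
    sin theta <= 2 exp (- m / 2), whose integral over [0, +oo) is 4. *)
Lemma height_bounded (m : R) : 0 <= m -> height m <= 4.
Proof.
  intros Hm.
  assert (H : - 4 * exp (- 0 / 2) - height 0 <= - 4 * exp (- m / 2) - height m).
  { apply (nondecreasing_of_derive (fun u => - 4 * exp (- u / 2) - height u)
             (fun u => 2 * exp (- u / 2) - sin_angle u / radius u)); trivial.
    - intros u Hu.
      apply (is_derive_minus (fun u => - 4 * exp (- u / 2)) height).
      + auto_derive; trivial. field_simplify. unfold Rdiv. lra.
      + apply is_derive_height.
    - intros u Hu.
      assert (H1 : sin_angle u <= 2 * exp (- u / 2)).
      { assert (Hp := exp_pos (- u / 2)).
        rewrite <- (sqrt_Rsqr (2 * exp (- u / 2))) by lra.
        apply sqrt_le_1_alt. unfold cos_angle.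
        replace (exp (- u)) with (exp (- u / 2) * exp (- u / 2))
          by (rewrite <- exp_plus; f_equal; field).
        unfold Rsqr. nra. }
      assert (H2 : sin_angle u / radius u <= sin_angle u).
      { rewrite <- (Rmult_1_r (sin_angle u)) at 2.
        apply Rmult_le_compat_l; [apply sqrt_pos|].
        rewrite <- Rinv_1. apply Rinv_le_contravar; [lra|apply radius_ge_1]. }
      lra. }
  rewrite height_0 in H.
  replace (- 0 / 2) with 0 in H by field. rewrite exp_0 in H.
  generalize (exp_pos (- m / 2)). lra.
Qed.

Lemma height_limit :
  exists c, filterlim height (Rbar_locally p_infty) (locally c).
Proof.
  assert (Hln : 0 < ln 2) by (rewrite <- ln_1; apply ln_increasing; lra).
  destruct (completeness (fun y => exists m, 0 <= m /\ y = height m))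
    as [c [Hub Hlub]].
  - exists 4. intros y [m [Hm ->]]. now apply height_bounded.
  - exists (height 0), 0. lra.
  - exists c. intros P [eps HP].
    assert (Hex : exists m, 0 <= m /\ c - eps < height m).
    { apply NNPP. intros Hno.
      assert (Hc : c <= c - eps).
      { apply Hlub. intros y [m [Hm ->]].
        apply Rnot_lt_le. intros H. apply Hno. now exists m. }
      generalize (cond_pos eps). lra. }
    destruct Hex as [m0 [Hm0 H0]].
    exists m0. intros m Hm. apply HP.
    assert (H1 := height_incr m0 m ltac:(lra) Hm).
    assert (H2 : height m <= c) by (apply Hub; exists m; split; [lra|trivial]).
    apply Rabs_def1; unfold minus, plus, opp; simpl; lra.
Qed.

Lemma radius_limit :
  filterlim radius (Rbar_locally p_infty) (Rbar_locally p_infty).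
Proof.
  intros P [K HK]. exists (K * K + 1). intros m Hm. apply HK.
  apply Rle_lt_trans with (Rabs K); [apply Rle_abs|].
  rewrite <- sqrt_Rsqr_abs. apply sqrt_lt_1_alt. unfold Rsqr.
  generalize (exp_pos (- m)). nra.
Qed.

(** * Every solution is a piece of the explicit curve *)

(** The system is singular where sin theta vanishes, so theta cannot cross
    0 or PI. *)
Lemma solution_angle_range (a b : Rbar) (x z theta : R -> R) (s : R) :
  is_solution (-1) a b x z theta -> in_Rbar_interval a b 0 ->
  theta 0 = PI / 2 -> in_Rbar_interval a b s -> 0 < theta s < PI.
Proof.
  intros Hsol H0 Hth Hs.
  assert (HPI := PI_RGT_0).
  assert (Hc : forall u, in_Rbar_interval a b u -> continuity_pt theta u).
  { intros u Hu. destruct (Hsol u Hu) as (_ & _ & _ & Hd).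
    now apply (continuity_pt_of_derive _ _ _ Hd). }
  split.
  - apply (positive_on_interval a b theta 0); trivial; [|lra].
    intros u Hu E. apply (proj1 (Hsol u Hu)). rewrite E. apply sin_0.
  - assert (0 < PI - theta s); [|lra].
    apply (positive_on_interval a b (fun u => PI - theta u) 0); trivial; [| |lra].
    + intros u Hu. apply continuity_pt_minus; auto.
      now apply continuity_pt_const.
    + intros u Hu E. apply (proj1 (Hsol u Hu)).
      replace (theta u) with PI by lra. apply sin_PI.
Qed.

(** Quadrature of the system.  The parameter m is a function on the given
    interval with m' = x; conservation of x^2 - 2 exp (- m) - 2 m gives x, and
    then both arc_length m - s and height m - z have derivative zero. *)
Lemma solution_is_explicit (a b : Rbar) (x z theta : R -> R) (s : R) :
  is_solution (-1) a b x z theta -> in_Rbar_interval a b 0 ->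
  x 0 = 1 -> z 0 = 0 -> theta 0 = PI / 2 ->
  in_Rbar_interval a b s ->
  exists m, - ln 2 < m /\ arc_length m = s /\ x s = radius m /\
            z s = height m /\ theta s = acos (cos_angle m).
Proof.
  intros Hsol H0 Hx0 Hz0 Hth0 Hs.
  set (m := fun u => - ln (1 - cos (theta u))).
  assert (Hrange : forall u, in_Rbar_interval a b u ->
            0 < theta u < PI /\ 0 < sin (theta u) /\ -1 < cos (theta u) < 1).
  { intros u Hu.
    assert (Ht := solution_angle_range a b x z theta u Hsol H0 Hth0 Hu).
    assert (Hsin := sin_gt_0 (theta u) (proj1 Ht) (proj2 Ht)).
    assert (Hsq := sin2_cos2 (theta u)). unfold Rsqr in Hsq.
    repeat split; trivial; try lra; nra. }
  assert (Hexp : forall u, in_Rbar_interval a b u ->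
            cos_angle (m u) = cos (theta u)).
  { intros u Hu. unfold cos_angle, m.
    rewrite Ropp_involutive, exp_ln; [lra|].
    destruct (Hrange u Hu) as (_ & _ & H). lra. }
  assert (Hsin : forall u, in_Rbar_interval a b u ->
            sin_angle (m u) = sin (theta u)).
  { intros u Hu. destruct (Hrange u Hu) as (_ & H & _).
    unfold sin_angle. rewrite Hexp by trivial.
    rewrite <- (sqrt_Rsqr (sin (theta u))) by lra.
    f_equal. generalize (sin2_cos2 (theta u)). lra. }
  assert (Hm0 : m 0 = 0).
  { unfold m. rewrite Hth0, cos_PI2, Rminus_0_r, ln_1. ring. }
  assert (Hdm : forall u, in_Rbar_interval a b u -> is_derive m u (x u)).
  { intros u Hu. destruct (Hsol u Hu) as (Hne & _ & _ & Hd).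
    destruct (Hrange u Hu) as (_ & _ & Hcos).
    evar_last.
    - apply (is_derive_comp (fun t => - ln (1 - cos t)) theta u); [|exact Hd].
      auto_derive; [lra|reflexivity].
    - unfold scal; simpl; unfold mult; simpl. field. lra. }
  (* the first integral, normalised by m = 0 and x = 1 at s = 0 *)
  assert (Hen : forall u, in_Rbar_interval a b u ->
            x u * x u = 2 * exp (- m u) + 2 * m u - 1).
  { intros u Hu.
    pose (E := fun t => x t * x t - (2 * exp (- m t) + 2 * m t - 1)).
    assert (HE : E u = E 0).
    { apply (constant_on_interval a b); trivial. intros t Ht.
      destruct (Hsol t Ht) as (_ & Hdx & _ & _). assert (Hdmt := Hdm t Ht).
      unfold E. auto_derive.
      - repeat split; trivial; eexists; eassumption.
      - rewrite (is_derive_unique (fun t : R => x t) _ _ Hdx),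
          (is_derive_unique (fun t : R => m t) _ _ Hdmt).
        rewrite <- Hexp by trivial. unfold cos_angle. ring. }
    unfold E in HE. rewrite Hm0, Hx0, Ropp_0, exp_0 in HE. lra. }
  assert (Hx : forall u, in_Rbar_interval a b u -> x u = radius (m u)).
  { intros u Hu.
    assert (Hpos : 0 < x u).
    { apply (positive_on_interval a b x 0); trivial; [| |lra].
      - intros t Ht. destruct (Hsol t Ht) as (_ & Hdx & _ & _).
        now apply (continuity_pt_of_derive _ _ _ Hdx).
      - intros t Ht E. assert (H := Hen t Ht).
        generalize (radius_sqr_ge_1 (m t)). rewrite E in H. lra. }
    unfold radius. rewrite <- Hen by trivial. symmetry. apply sqrt_square. lra. }
  exists (m s). destruct (Hrange s Hs) as (Ht & _ & Hcos).
  repeat split.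
  - unfold m. apply Ropp_lt_contravar, ln_increasing; lra.
  - assert (H : arc_length (m s) - s = arc_length (m 0) - 0).
    { apply (constant_on_interval a b (fun u => arc_length (m u) - u)); trivial.
      intros u Hu. evar_last.
      - apply (is_derive_minus (fun u => arc_length (m u)) (fun u => u)).
        + apply (is_derive_comp arc_length m);
            [apply is_derive_arc_length | now apply Hdm].
        + apply (is_derive_id (K := R_AbsRing)).
      - rewrite Hx by trivial.
        unfold minus, plus, opp, scal, one; simpl; unfold mult; simpl.
        field. generalize (radius_ge_1 (m u)). lra. }
    rewrite Hm0, arc_length_0 in H. lra.
  - now apply Hx.
  - assert (H : height (m s) - z s = height (m 0) - z 0).
    { apply (constant_on_interval a b (fun u => height (m u) - z u)); trivial.
      intros u Hu. destruct (Hsol u Hu) as (_ & _ & Hdz & _). evar_last.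
      - apply (is_derive_minus (fun u => height (m u)) z); [|exact Hdz].
        apply (is_derive_comp height m);
          [apply is_derive_height | now apply Hdm].
      - rewrite Hx, Hsin by trivial.
        unfold minus, plus, opp, scal; simpl; unfold mult; simpl.
        field. generalize (radius_ge_1 (m u)). lra. }
    rewrite Hm0, height_0, Hz0 in H. lra.
  - rewrite Hexp by trivial. symmetry. apply acos_cos. lra.
Qed.

(** * The explicit curve solves the system *)

(** The time at which theta would reach PI. *)
Definition start : R := arc_length (- ln 2).

Definition parameter_at (s : R) : R := preimage arc_length s.

Lemma parameter_at_arc_length (m : R) : parameter_at (arc_length m) = m.
Proof.
  apply (preimage_image arc_length _ m is_derive_arc_length inv_radius_pos).
Qed.

Lemma is_derive_parameter_at (m : R) :
  is_derive parameter_at (arc_length m) (radius m).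
Proof.
  rewrite <- (Rinv_inv (radius m)).
  apply (is_derive_preimage arc_length _ m is_derive_arc_length inv_radius_pos).
Qed.

(** With m = parameter_at s, the inverse function theorem gives m' = radius m,
    and each equation of the system follows by the chain rule. *)
Lemma explicit_is_solution :
  is_solution (-1) start p_infty
    (fun s => radius (parameter_at s)) (fun s => height (parameter_at s))
    (fun s => acos (cos_angle (parameter_at s))).
Proof.
  intros s [Hs _]. simpl in Hs.
  destruct (arc_length_surj _ s Hs) as [m [Hm <-]].
  rewrite parameter_at_arc_length.
  assert (Hcos := cos_angle_bounds m Hm).
  assert (Hsin := sin_angle_pos m Hm).
  assert (Hr := radius_ge_1 m).
  assert (Hd := is_derive_parameter_at m).
  assert (Es : sin (acos (cos_angle m)) = sin_angle m)
    by (apply sin_acos; lra).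
  assert (Hacos : is_derive acos (cos_angle m) (-1 / sin_angle m)).
  { apply is_derive_Reals. unfold sin_angle.
    rewrite <- (derive_pt_acos _ Hcos). apply derive_pt_eq_1 with (derivable_pt_acos _ Hcos).
    reflexivity. }
  assert (Hdcos : is_derive cos_angle m (exp (- m))).
  { unfold cos_angle. auto_derive; trivial. ring. }
  rewrite Es, cos_acos by lra.
  split; [lra|]. split; [|split].
  - evar_last.
    + apply (is_derive_comp radius parameter_at); [|exact Hd].
      rewrite parameter_at_arc_length. apply is_derive_radius.
    + unfold scal; simpl; unfold mult; simpl. field. lra.
  - evar_last.
    + apply (is_derive_comp height parameter_at); [|exact Hd].
      rewrite parameter_at_arc_length. apply is_derive_height.
    + unfold scal; simpl; unfold mult; simpl. field. lra.
  - evar_last.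
    + apply (is_derive_comp (fun u => acos (cos_angle u)) parameter_at);
        [|exact Hd].
      rewrite parameter_at_arc_length.
      apply (is_derive_comp acos cos_angle); [exact Hacos | exact Hdcos].
    + unfold scal; simpl; unfold mult; simpl. unfold cos_angle. field. lra.
Qed.

Lemma parameter_at_limit :
  filterlim parameter_at (at_endpoint start p_infty p_infty)
    (Rbar_locally p_infty).
Proof.
  intros P [m0 HP]. exists (arc_length m0). intros s Hs [Hs' _].
  destruct (arc_length_surj m0 s Hs) as [m [Hm <-]].
  rewrite parameter_at_arc_length. now apply HP.
Qed.

(** * The maximal solution *)

(** If the interval began before [start], the solution would be defined at
    [start] with parameter - ln 2, which is excluded.  So the explicit curve extends the given solution, and
    maximality forces the two intervals to coincide. *)
Lemma maximal_solution_interval (a b : Rbar) (x z theta : R -> R) :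
  in_Rbar_interval a b 0 -> is_maximal_solution (-1) a b x z theta ->
  x 0 = 1 -> z 0 = 0 -> theta 0 = PI / 2 ->
  a = Finite start /\ b = p_infty.
Proof.
  intros H0 [Hsol Hmax] Hx0 Hz0 Hth0.
  assert (Hexp := fun s =>
            solution_is_explicit a b x z theta s Hsol H0 Hx0 Hz0 Hth0).
  assert (Ha : Rbar_le start a).
  { apply Rbar_not_lt_le. intros Ha.
    assert (Hs0 : start < 0)
      by (rewrite <- arc_length_0; apply arc_length_incr;
          rewrite <- Ropp_0; apply Ropp_lt_contravar;
          rewrite <- ln_1; apply ln_increasing; lra).
    destruct (Hexp start) as [m [Hm [E _]]].
    - split; trivial. apply Rbar_lt_trans with 0; [exact Hs0 | apply H0].
    - apply arc_length_incr in Hm. fold start in Hm. lra. }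
  destruct (Hmax start p_infty _ _ _ Ha (ltac:(now destruct b)) explicit_is_solution)
    as [E1 E2].
  - intros s Hs. destruct (Hexp s Hs) as (m & _ & <- & -> & -> & ->).
    rewrite parameter_at_arc_length. auto.
  - auto.
Qed.

Theorem theorem4p4 (a b : Rbar) (x z theta : R -> R)
    (h0 : in_Rbar_interval a b 0)
    (hmax : is_maximal_solution (-1) a b x z theta)
    (hx0 : x 0 = 1) (hz0 : z 0 = 0) (htheta0 : theta 0 = PI / 2) :
  graph_on_z_axis a b x z /\
  ((branch_asymptotic_to_horizontal_line a b b x z /\ is_finite a) \/
   (branch_asymptotic_to_horizontal_line a b a x z /\ is_finite b)).
Proof.
  destruct (maximal_solution_interval a b x z theta) as [-> ->]; trivial.
  assert (Hexp : forall s, in_Rbar_interval start p_infty s ->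
            exists m, - ln 2 < m /\ arc_length m = s /\
                      x s = radius m /\ z s = height m).
  { intros s Hs.
    destruct (solution_is_explicit _ _ x z theta s (proj1 hmax)) as (m & H);
      trivial.
    exists m. tauto. }
  split.
  - pose (parameter_of_height := fun w =>
            epsilon (inhabits 0) (fun m => - ln 2 < m /\ height m = w)).
    assert (Hpar : forall m, - ln 2 < m -> parameter_of_height (height m) = m).
    { intros m Hm.
      destruct (epsilon_spec (inhabits 0)
                  (fun u => - ln 2 < u /\ height u = height m)) as [Hu E].
      - now exists m.
      - fold (parameter_of_height (height m)) in Hu, E.
        destruct (Rtotal_order (parameter_of_height (height m)) m)
          as [H | [H | H]]; trivial; apply height_incr in H; trivial; lra. }
    exists (fun w => exists m, - ln 2 < m /\ height m = w).
    exists (fun w => radius (parameter_of_height w)).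
    split.
    + intros u v w [m1 [Hm1 <-]] [m2 [Hm2 <-]] Hw.
      assert (H12 : m1 <= m2).
      { apply Rnot_lt_le. intros H. apply height_incr in H; trivial. lra. }
      destruct (intermediate_value height m1 m2 w) as [m [Hm E]]; trivial.
      * intros t _. apply (continuity_pt_of_derive _ _ _ (is_derive_height t)).
      * exists m. split; trivial. lra.
    + intros p. split.
      * intros [s [Hs <-]]. destruct (Hexp s Hs) as (m & Hm & _ & Hx & Hz).
        exists (height m). split; [now exists m|].
        unfold gamma. rewrite Hpar, Hx, Hz; trivial.
      * intros [w [[m [Hm <-]] ->]]. exists (arc_length m).
        assert (Hs : in_Rbar_interval start p_infty (arc_length m))
          by (split; simpl; trivial; now apply arc_length_incr).
        split; trivial.
        destruct (Hexp _ Hs) as (m' & Hm' & E & Hx & Hz).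
        assert (m' = m) as -> by
          (rewrite <- (parameter_at_arc_length m'), E;
           apply parameter_at_arc_length).
        unfold gamma. rewrite Hpar, Hx, Hz; trivial.
  - left. split; [|reflexivity].
    destruct height_limit as [c Hc]. exists c.
    split.
    + apply (filterlim_within_ext _ (fun s => radius (parameter_at s))).
      * intros s Hs. destruct (Hexp s Hs) as (m & _ & <- & -> & _).
        now rewrite parameter_at_arc_length.
      * exact (filterlim_comp _ _ _ parameter_at radius _ _ _
                 parameter_at_limit radius_limit).
    + apply (filterlim_within_ext _ (fun s => height (parameter_at s))).
      * intros s Hs. destruct (Hexp s Hs) as (m & _ & <- & _ & ->).
        now rewrite parameter_at_arc_length.
      * exact (filterlim_comp _ _ _ parameter_at height _ _ _
                 parameter_at_limit Hc).
Qed.
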